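(* The metric projective space $(\mathfrak P,\perp)$ is not definable in terms of the geometry of $\mathfrak B_1$.
   Context: Setting. $\mathfrak F$ is a perfect field of characteristic $2$, $\mathbb V$ is a vector space over $\mathfrak F$ of finite dimension $n\ge 2$, and $\mathfrak P$ is the projective space of $\mathbb V$ (points are $\langle u\rangle$ with $u\in\mathbb V$ nonzero). Lines of $\mathfrak P$ have at least $6$ points. $\xi$ is a nondegenerate symmetric bilinear form on $\mathbb V$ which is not alternating, and $\langle u\rangle\perp\langle v\rangle$ means $\xi(u,v)=0$. The set $\mathbf H$ of selfconjugate points ($p\perp p$) is then a hyperplane of $\mathfrak P$ ($\perp$ is a pseudo-polarity), and its pole is a point $\mathbf b$ (so $\mathbf b^\perp=\mathbf H$); $\mathbf b$ may or may not lie on $\mathbf H$. For a subspace $U$ of $\mathfrak P$, $\dim(U)$ is the vector dimension (points have dimension $1$, lines $2$), $U^\perp=\{p: p\perp q\text{ for all }q\in U\}$, $\mathrm{Rad}(U)=U\cap U^\perp$, and $U$ is regular if $\mathrm{Rad}(U)=\emptyset$. Thus the regular points are exactly the points not on $\mathbf H$. Structures. $(\mathfrak P,\perp)$ is the projective space $\mathfrak P$ (points, lines, incidence) equipped with the binary relation $\perp$ on its points. $\mathfrak B_1$ is the point-line structure with points the regular points different from $\mathbf b$, lines the regular lines not contained in $\mathbf H$, and natural incidence. Definability. Let $M,N$ be structures whose elements are points or subspaces of $\mathfrak P$. $N$ is definable in terms of $M$ if it can be described using only the primitive notions of $M$: the elements of $N$ can be represented by tuples of elements of $M$ ranging over sets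 given by parameter-free first-order formulas in the language of $M$, modulo equivalence relations given by such formulas, in such a way that all the primitive relations of $N$, and the natural inclusion relations between elements of $N$ and elements of $M$ (as subspaces of $\mathfrak P$), are given by such formulas as well. *)

(* Defs.v *)
From HB Require Import structures.
From mathcomp Require Import all_boot all_order all_algebra all_field.

Set Implicit Arguments.
Unset Strict Implicit.
Unset Printing Implicit Defensive.

Import GRing.Theory.
Local Open Scope ring_scope.

Record language := Language { symbol : Type; arity : symbol -> nat }.

(* First-order formulas without parameters, with free variables in [X]; the
   variable bound by [FAll] is [None]. The remaining connectives are
   classically definable from these. *)
Inductive formula (L : language) (X : Type) : Type :=
| FFalse
| FEq of X & X
| FRel (r : symbol L) of 'I_(arity r) -> X
| FImp of formula L X & formula L X
| FAll of formula L (option X).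

Section Structures.
Variables (F : fieldType) (V : vectType F).

(* A relational structure whose elements are subspaces of V. It is one-sorted:
   a distinction between sorts, e.g. points and lines, is made by unary
   relation symbols. *)
Record geometry := Geometry {
  lang : language;
  elt : pred {vspace V};
  rel_of : forall r : symbol lang, ('I_(arity r) -> {vspace V}) -> Prop
}.

Definition carrier (M : geometry) := {U : {vspace V} | elt M U}.

Fixpoint holds (M : geometry) (X : Type) (f : formula (lang M) X) :
    (X -> carrier M) -> Prop :=
  match f with
  | FFalse => fun _ => False
  | FEq x y => fun e => e x = e y
  | FRel r v => fun e => rel_of (fun k => val (e (v k)))
  | FImp f1 f2 => fun e => holds f1 e -> holds f2 e
  | FAll f1 => fun e => forall a, holds f1 (oapp e a)
  end.

Definition env2 (T : Type) (m n : nat) (t : m.-tuple T) (u : n.-tuple T)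
    (x : 'I_m + 'I_n) : T :=
  match x with inl i => tnth t i | inr j => tnth u j end.

Definition env_family (T : Type) (m : nat) (n : 'I_m -> nat)
    (t : forall k, (n k).-tuple T) (x : {k : 'I_m & 'I_(n k)}) : T :=
  tnth (t (tag x)) (tagged x).

(* The elements of N are represented by tuples of elements of M: for [i] in a
   finite index set, [rep i] sends the tuples in the set defined by [dom i] to
   the elements of N that they represent (its values on other tuples are
   irrelevant). [eqv i j] defines the equivalence of representatives. *)
Record interpretation (N M : geometry) := Interpretation {
  index : finType;
  len : index -> nat;
  rep : forall i, (len i).-tuple (carrier M) -> carrier N;
  dom : forall i, formula (lang M) 'I_(len i);
  eqv : forall i j, formula (lang M) ('I_(len i) + 'I_(len j));
  rel_def : forall (r : symbol (lang N)) (c : 'I_(arity r) -> index),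
    formula (lang M) {k : 'I_(arity r) & 'I_(len (c k))};
  sub_def : forall i, formula (lang M) ('I_1 + 'I_(len i));
  sup_def : forall i, formula (lang M) ('I_1 + 'I_(len i));
  rep_surj : forall x : carrier N,
    exists i, exists2 t, holds (dom i) (tnth t) & rep t = x;
  rep_eqv : forall i j t u, holds (dom i) (tnth t) -> holds (dom j) (tnth u) ->
    (rep t = rep u <-> holds (eqv i j) (env2 t u));
  rep_rel : forall (r : symbol (lang N)) (c : 'I_(arity r) -> index)
      (t : forall k, (len (c k)).-tuple (carrier M)),
    (forall k, holds (dom (c k)) (tnth (t k))) ->
    (rel_of (fun k => val (rep (t k))) <->
     holds (rel_def c) (env_family t));
  rep_sub : forall i t (a : carrier M), holds (dom i) (tnth t) ->
    ((val a <= val (rep t))%VS <-> holds (sub_def i) (env2 [tuple a] t));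
  rep_sup : forall i t (a : carrier M), holds (dom i) (tnth t) ->
    ((val (rep t) <= val a)%VS <-> holds (sup_def i) (env2 [tuple a] t))
}.

Definition definable_in (N M : geometry) : Prop := inhabited (interpretation N M).

Definition is_point (U : {vspace V}) : bool := \dim U == 1%N.
Definition is_line (U : {vspace V}) : bool := \dim U == 2.

Variable xi : {symmetric V}.

Definition alternating : Prop := forall u, xi u u = 0.

Definition perp (p q : {vspace V}) : bool := (p <= orthov xi q)%VS.

Definition Rad (U : {vspace V}) : {vspace V} := (U :&: orthov xi U)%VS.

Definition regular (U : {vspace V}) : bool := Rad U == 0%VS.

Inductive metric_symbol := MPoint | MLine | MInc | MPerp.

Definition metric_arity (r : metric_symbol) : nat :=
  match r with MPoint => 1 | MLine => 1 | MInc => 2 | MPerp => 2 end%N.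

Definition metric_rel (r : metric_symbol) :
    ('I_(metric_arity r) -> {vspace V}) -> Prop :=
  match r return ('I_(metric_arity r) -> {vspace V}) -> Prop with
  | MPoint => fun e => is_point (e ord0)
  | MLine => fun e => is_line (e ord0)
  | MInc => fun e =>
      [/\ is_point (e ord0), is_line (e ord_max) & (e ord0 <= e ord_max)%VS]
  | MPerp => fun e =>
      [/\ is_point (e ord0), is_point (e ord_max) & perp (e ord0) (e ord_max)]
  end.

Definition metric_space : geometry := {|
  lang := {| symbol := metric_symbol; arity := metric_arity |};
  elt := fun U => is_point U || is_line U;
  rel_of := metric_rel |}.

Inductive incidence_symbol := IPoint | ILine | IInc.

Definition incidence_arity (r : incidence_symbol) : nat :=
  match r with IPoint => 1 | ILine => 1 | IInc => 2 end%N.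

Definition incidence_rel (P L : pred {vspace V}) (r : incidence_symbol) :
    ('I_(incidence_arity r) -> {vspace V}) -> Prop :=
  match r return ('I_(incidence_arity r) -> {vspace V}) -> Prop with
  | IPoint => fun e => P (e ord0)
  | ILine => fun e => L (e ord0)
  | IInc => fun e => [/\ P (e ord0), L (e ord_max) & (e ord0 <= e ord_max)%VS]
  end.

Definition point_line (P L : pred {vspace V}) : geometry := {|
  lang := {| symbol := incidence_symbol; arity := incidence_arity |};
  elt := fun U => P U || L U;
  rel_of := incidence_rel P L |}.

Definition B1 (H b : {vspace V}) : geometry :=
  point_line (fun p => [&& is_point p, regular p & p != b])
             (fun l => [&& is_line l, regular l & ~~ (l <= H)%VS]).

End Structures.

Definition perfect_field (F : fieldType) : Prop :=
  forall p : {poly F}, irreducible_poly p -> separable_poly p.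

(* Main.v *)
Require Import Defs.
From mathcomp Require Import all_boot all_order all_algebra all_field.
From HB Require Import structures.
From mathcomp Require Import ring.
From Stdlib Require Import FunctionalExtensionality.

Set Implicit Arguments.
Unset Strict Implicit.
Unset Printing Implicit Defensive.

Import GRing.Theory.
Local Open Scope ring_scope.

(** If [N] is definable in [M], then every automorphism of [M] extends to [N]
    compatibly with inclusion; in particular it preserves the relations of [N]
    between those elements of [N] that are also elements of [M]
    ([definable_rel_invariant]). So it suffices to exhibit an automorphism of
    the geometry B1 that does not preserve perpendicularity of its points.

    Let [b] be a vector spanning the pole and put [l u = xi u b], so that [l]
    vanishes exactly on the selfconjugate vectors. Choose [e] with [l e = 1] and
    put [k = xi e e]. The form
      [omega u v = xi u v + k * l u * l v]
    is alternating. A vector of the radical of a subspace [U] is selfconjugate,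
    hence [l] vanishes at it, and [xi] agrees with [omega] there: regularity of
    [U] depends only on [l] and on [omega] up to a factor. Consequently every
    linear bijection [T] that fixes [l], multiplies [omega] by a nonzero
    scalar, and fixes the pole is an automorphism of B1.

    For a scalar [d] different from 0 and 1 there is such a [T] with factor
    [d ^+ 2], the map [stretch]:
    - if [xi b b] is nonzero, take [e] in the span of [b]; the space is the sum
      of [b] and its perp, and [T] is the identity on the first summand and
      multiplication by [d] on the second;
    - if [xi b b = 0], then [omega] is nondegenerate and [(e, b)] is a
      hyperbolic pair; [T] fixes [e], multiplies [b] by [d ^+ 2], and is
      multiplication by [d] on the [omega]-complement of the pair.

    Since [xi = omega + k * l * l], this gives ([form_stretch])
      [xi (T u) (T v) = d ^+ 2 * xi u v + (1 - d) ^+ 2 * k * l u * l v],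
    so no two perpendicular points off the hyperplane of selfconjugate points
    have perpendicular images. Such a pair of points exists in B1
    ([exists_perp_pair]), and [d] exists because lines have more than three
    points. *)

(** * Automorphisms and definability *)

Section Definability.
Variables (F : fieldType) (V : vectType F).
Implicit Types (M N : geometry V).

Definition automorphism M (s : carrier M -> carrier M) : Prop :=
  bijective s /\ forall (r : symbol (lang M)) (p : 'I_(arity r) -> carrier M),
    rel_of (fun k => val (p k)) <-> rel_of (fun k => val (s (p k))).

Lemma holds_automorphism M s X (f : formula (lang M) X) (e : X -> carrier M) :
  automorphism s -> (holds f e <-> holds f (s \o e)).
Proof.
move=> [[s' sK s'K] s_rel].
elim: X / f e => [X|X x y|X r v|X f IHf g IHg|X f IHf] e //=.
- by split=> [->|/(can_inj sK)].
- exact: s_rel.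
- by rewrite IHf IHg.
have shift a : s \o oapp e a = oapp (s \o e) (s a).
  by apply: functional_extensionality => -[].
split=> all_f a; last by rewrite IHf shift.
by rewrite -[a]s'K -shift -IHf.
Qed.

(** An interpretation carries the action of [s] over to [N]. Since inclusion
    between elements of [M] and of [N] is given by formulas, this action agrees
    with [s] on an element common to both structures, and the relations of [N],
    being given by formulas as well, are preserved. *)
Lemma definable_rel_invariant N M s (r : symbol (lang N))
    (p : 'I_(arity r) -> carrier M) :
  definable_in N M -> automorphism s -> (forall k, elt N (val (p k))) ->
  (rel_of (fun k => val (p k)) <-> rel_of (fun k => val (s (p k)))).
Proof.
move=> [I] aut_s Np.
have tnth_s n (t : n.-tuple (carrier M)) : tnth (map_tuple s t) = s \o tnth t.
  by apply: functional_extensionality => k; rewrite tnth_map.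
have env2_s a n (t : n.-tuple (carrier M)) :
    env2 [tuple s a] (map_tuple s t) = s \o env2 [tuple a] t.
  apply: functional_extensionality => -[k|k] /=; last exact: tnth_map.
  by rewrite !(tnth_nth a) ord1.
have dom_s i (t : (len i).-tuple (carrier M)) :
    holds (@dom _ _ _ _ I i) (tnth t) -> holds (dom i) (tnth (map_tuple s t)).
  by rewrite tnth_s -holds_automorphism.
(* A tuple represents the element a of M exactly when a includes and is
   included in what the tuple represents; both are expressed by formulas. *)
have rep_s i (t : (len i).-tuple (carrier M)) a :
    holds (@dom _ _ _ _ I i) (tnth t) ->
    val (rep t) = val a -> val (rep (map_tuple s t)) = val (s a).
  move=> dom_t rep_t; apply/eqP; rewrite eqEsubv; apply/andP; split.
  - apply/(rep_sup (s a) (dom_s _ _ dom_t)).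
    rewrite env2_s -holds_automorphism //.
    by apply/(rep_sup a dom_t); rewrite rep_t.
  apply/(rep_sub (s a) (dom_s _ _ dom_t)).
  rewrite env2_s -holds_automorphism //.
  by apply/(rep_sub a dom_t); rewrite rep_t.
have /fin_all_exists[z zP] k :
    exists z : {i : Defs.index I & (len i).-tuple (carrier M)},
    holds (dom (tag z)) (tnth (tagged z)) /\ val (rep (tagged z)) = val (p k).
  have [i [t dom_t rep_t]] := rep_surj I (Sub (val (p k)) (Np k)).
  by exists (existT _ i t); split=> //=; rewrite rep_t SubK.
pose t k := tagged (z k).
have dom_t k : holds (dom (tag (z k))) (tnth (t k)) by case: (zP k).
have rep_t k : val (rep (t k)) = val (p k) by case: (zP k).
have -> : (fun k => val (p k)) = (fun k => val (rep (t k))).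
  by apply: functional_extensionality => k; rewrite rep_t.
have -> : (fun k => val (s (p k))) = (fun k => val (rep (map_tuple s (t k)))).
  by apply: functional_extensionality => k; rewrite (rep_s _ _ (p k)).
rewrite rep_rel // rep_rel; last by move=> k; apply: dom_s.
have -> : env_family (fun k => map_tuple s (t k)) = s \o env_family t.
  by apply: functional_extensionality => -[k j]; apply: tnth_map.
exact: holds_automorphism.
Qed.
Lemma point_line_automorphism (P L : pred {vspace V}) (f : 'End(V)) :
    lker f == 0%VS -> (forall U, P (f @: U)%VS = P U) ->
    (forall U, L (f @: U)%VS = L U) ->
  exists2 s : carrier (point_line P L) -> carrier (point_line P L),
    automorphism s & forall a, val (s a) = (f @: val a)%VS.
Proof.
move=> f0 fP fL.
have elt_f U : elt (point_line P L) U -> elt (point_line P L) (f @: U)%VS.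
  by rewrite /= fP fL.
have fVK U : (f @: (f^-1 @: U))%VS = U.
  by rewrite -limg_comp lker0_compfV // lim1g.
have fK U : (f^-1 @: (f @: U))%VS = U.
  by rewrite -limg_comp lker0_compVf // lim1g.
have elt_fV U : elt (point_line P L) U -> elt (point_line P L) (f^-1 @: U)%VS.
  by rewrite /= -(fP (f^-1 @: U)%VS) -(fL (f^-1 @: U)%VS) fVK.
pose s (a : carrier (point_line P L)) : carrier (point_line P L) :=
  exist _ (f @: val a)%VS (elt_f _ (valP a)).
pose s' (a : carrier (point_line P L)) : carrier (point_line P L) :=
  exist _ (f^-1 @: val a)%VS (elt_fV _ (valP a)).
exists s => //; split.
  by exists s' => a; apply: val_inj; rewrite /= ?fVK ?fK.
by case=> p /=; rewrite ?fP ?fL ?limg_ker0.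
Qed.
End Definability.

(** * A linear map that is an automorphism of B1 *)

Section Stretch.
Variables (F : fieldType) (V : vectType F) (xi : {symmetric V}).
Variables (b e : V) (d : F).

Lemma form_sym u v : xi u v = xi v u.
Proof. by rewrite hermC expr0 mul1r. Qed.

(** The coefficient of [b] contains [omega u e]. In a hyperbolic basis [(e, b)]
    the coordinates of [u] along [e] and [b] are [xi u b] and [omega u e], so
    that the corrections to [d *: u] act on these two coordinates only; when
    [e] is a multiple of [b] the last term vanishes. *)
Definition stretch u : V :=
  d *: u + ((1 - d) * xi u b) *: e
  + ((d ^+ 2 - d) * (xi u e + xi e e * xi u b)) *: b.

Lemma stretch_is_linear : linear stretch.
Proof.
move=> a u v; rewrite /stretch !linearPl /=.
have -> : (1 - d) * (a * xi u b + xi v b)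
    = a * ((1 - d) * xi u b) + (1 - d) * xi v b by ring.
have -> : (d ^+ 2 - d) * (a * xi u e + xi v e + xi e e * (a * xi u b + xi v b))
    = a * ((d ^+ 2 - d) * (xi u e + xi e e * xi u b))
      + (d ^+ 2 - d) * (xi v e + xi e e * xi v b) by ring.
rewrite !scalerDr !scalerDl !scalerA [d * a]mulrC.
by rewrite [in RHS]addrACA [X in X + _ = _]addrACA.
Qed.

HB.instance Definition _ :=
  GRing.isLinear.Build F V V *:%R stretch stretch_is_linear.

Hypothesis eb1 : xi e b = 1.
(** Either [xi b b = 0], or [omega u e = 0] for all [u], that is, [e] spans the
    pole. As an equation this covers both cases at once. *)
Hypothesis e_b : forall u, (xi u e + xi e e * xi u b) * xi b b = 0.

Lemma form_stretch_pole u : xi (stretch u) b = xi u b.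
Proof.
rewrite /stretch !linearDl !linearZl_LR /= eb1 -[_ * _ * xi b b]mulrA e_b.
by ring.
Qed.

(** All terms with [xi u e] or [xi v e] cancel in every characteristic; in
    characteristic 2 the rest says that [stretch] multiplies [omega] by
    [d ^+ 2] and fixes [xi _ b]. *)
Lemma form_stretch u v : 2%N \in [pchar F] ->
  xi (stretch u) (stretch v)
  = d ^+ 2 * xi u v + (1 - d) ^+ 2 * xi e e * xi u b * xi v b.
Proof.
move=> charF.
have two0 : 1 + 1 = 0 :> F by exact: pcharf0 charF.
rewrite {2}/stretch !linearDr !linearZr_LR /= form_stretch_pole.
rewrite /stretch !linearDl !linearZl_LR /= (form_sym b e) eb1.
rewrite (form_sym e v) (form_sym b v) .
transitivity (d ^+ 2 * xi u v + (1 - d) ^+ 2 * xi e e * xi u b * xi v b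
  + (1 + 1) * ((d ^+ 2 - d) * xi e e * xi u b * xi v b)); first by ring.
by rewrite two0 mul0r addr0.
Qed.

Hypotheses (charF : 2%N \in [pchar F]) (nondeg : nondegenerate xi).
Hypothesis selfconjE : forall u, (xi u u == 0) = (xi u b == 0).
Hypothesis d_neq0 : d != 0.

Let f : 'End(V) := linfun stretch.

Lemma nondegenerateP w : w != 0 -> exists v, xi w v != 0.
Proof.
move=> w0; have /mem_orthovPn[v _ wv] : w \notin orthov xi fullv.
  by rewrite (eqP nondeg) memv0.
by exists v.
Qed.

(** For [u] in the kernel, [xi u b = 0] as [stretch] preserves [xi _ b]; then
    [form_stretch] leaves [0 = d ^+ 2 * xi u v] for all [v]. *)
Lemma lker_stretch : lker f == 0%VS.
Proof.
apply/eqP/vspaceP => u; rewrite memv0 memv_ker lfunE /=.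
apply/eqP/eqP => [Tu0|->]; last exact: linear0.
apply/eqP/negP => /negP/nondegenerateP[v /eqP[]].
have ub0 : xi u b = 0 by rewrite -form_stretch_pole Tu0 linear0l.
have := form_stretch u v charF.
rewrite Tu0 linear0l ub0 mulr0 mul0r addr0 => /esym/eqP.
by rewrite mulf_eq0 expf_eq0 /= (negPf d_neq0) => /eqP.
Qed.

(** Radical vectors are selfconjugate, hence orthogonal to [b]; on such vectors
    [stretch] multiplies the form by [d ^+ 2], so that orthogonality to the rest
    of [U] is neither lost nor gained. *)
Lemma Rad_stretch U : Rad xi (f @: U) = (f @: Rad xi U)%VS.
Proof.
have isoRad x v : xi x b = 0 -> xi (stretch x) (stretch v) = d ^+ 2 * xi x v.
  by move=> xb0; rewrite form_stretch // xb0 mulr0 mul0r addr0.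
have Rad_pole W x : x \in Rad xi W -> xi x b = 0.
  rewrite memv_cap => /andP[xW /mem_orthovP/(_ x xW)/eqP].
  by rewrite selfconjE => /eqP.
apply/eqP; rewrite eqEsubv; apply/andP; split; apply/subvP => y.
  move=> yR; have := Rad_pole _ _ yR; move: yR.
  rewrite memv_cap => /andP[/memv_imgP[x xU ->] /mem_orthovP fxP].
  rewrite lfunE /= form_stretch_pole => xb0.
  rewrite -[stretch x](lfunE stretch) memv_img // memv_cap xU.
  apply/mem_orthovP => v vU; have := fxP _ (memv_img f vU).
  rewrite !lfunE /= isoRad // => /eqP.
  by rewrite mulf_eq0 expf_eq0 /= (negPf d_neq0) => /eqP.
move=> /memv_imgP[x xR ->]; have xb0 := Rad_pole _ _ xR.
move: xR; rewrite memv_cap => /andP[xU /mem_orthovP xP].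
rewrite memv_cap memv_img //; apply/mem_orthovP => _ /memv_imgP[v vU ->].
by rewrite !lfunE /= isoRad // xP // mulr0.
Qed.

Lemma regular_stretch U : regular xi (f @: U) = regular xi U.
Proof.
by rewrite /regular Rad_stretch -{1}(limg0 f) eq_limg_ker0 // lker_stretch.
Qed.

Lemma stretch_sub_pole_perp U :
  (f @: U <= orthov xi <[b]>)%VS = (U <= orthov xi <[b]>)%VS.
Proof.
apply/subvP/subvP => UH u uU; last first.
  move: uU => /memv_imgP[x xU ->].
  by rewrite mem_orthov1 lfunE /= form_stretch_pole -mem_orthov1 UH.
have := UH _ (memv_img f uU).
by rewrite !mem_orthov1 lfunE /= form_stretch_pole.
Qed.

Lemma limg_stretch_pole : (f @: <[b]> = <[b]>)%VS.
Proof.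
apply/eqP; rewrite eqEdim limg_dim_eq ?(eqP lker_stretch) ?capv0 // leqnn andbT.
rewrite limg_line -memvE lfunE /= /stretch.
apply: rpredD; last by rewrite rpredZ ?memv_line.
apply: rpredD; first by rewrite rpredZ ?memv_line.
have [->|bb0] := eqVneq (xi b b) 0; first by rewrite mulr0 scale0r mem0v.
(* Now e is in the radical of omega, which is spanned by b. *)
suff -> : e = - (xi e e *: b) by rewrite rpredZ // rpredN rpredZ ?memv_line.
apply/eqP; rewrite -addr_eq0; apply/negP => /negP/nondegenerateP[u /eqP[]].
rewrite linearDl linearZl_LR /= (form_sym e) (form_sym b).
by apply/eqP; have /eqP := e_b u; rewrite mulf_eq0 (negPf bb0) orbF.
Qed.

Lemma is_point_stretch U : is_point (f @: U)%VS = is_point U.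
Proof. by rewrite /is_point limg_dim_eq // (eqP lker_stretch) capv0. Qed.

Lemma is_line_stretch U : is_line (f @: U)%VS = is_line U.
Proof. by rewrite /is_line limg_dim_eq // (eqP lker_stretch) capv0. Qed.

Lemma stretch_B1_automorphism :
  exists2 s : carrier (B1 xi (orthov xi <[b]>) <[b]>) -> _,
    automorphism s & forall a, val (s a) = (f @: val a)%VS.
Proof.
apply: point_line_automorphism lker_stretch _ _ => U.
  rewrite is_point_stretch regular_stretch -{1}limg_stretch_pole.
  by rewrite eq_limg_ker0 // lker_stretch.
by rewrite is_line_stretch regular_stretch stretch_sub_pole_perp.
Qed.

Lemma stretch_not_perp u v : d != 1 ->
  xi u v = 0 -> xi u b != 0 -> xi v b != 0 -> xi (stretch u) (stretch v) != 0.
Proof.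
move=> d1 uv ub vb; rewrite form_stretch // uv mulr0 add0r.
have ee0 : xi e e != 0 by rewrite selfconjE eb1 oner_neq0.
by rewrite !mulf_neq0 // subr_eq0 eq_sym.
Qed.
End Stretch.

(** * Choice of the vectors and of the scalar *)

Lemma is_pointP (F : fieldType) (V : vectType F) (p : {vspace V}) :
  is_point p -> exists2 u, u != 0 & p = <[u]>%VS.
Proof.
move=> /eqP dim_p; have p0 : p != 0%VS by rewrite -dimv_eq0 dim_p.
exists (vpick p); first by rewrite vpick0.
by apply/eqP; rewrite eq_sym eqEdim -memvE memv_pick dim_vline vpick0 p0 dim_p.
Qed.

Lemma is_point_vline (F : fieldType) (V : vectType F) (u : V) :
  is_point <[u]> = (u != 0).
Proof. by rewrite /is_point dim_vline eqb1. Qed.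

Section Existence.
Variables (F : fieldType) (V : vectType F) (xi : {symmetric V}) (b : V).
Hypothesis b_neq0 : b != 0.

(** Away from the case [xi b b = 0], [e] must span the pole, and the required
    identity [xi u e + xi e e * xi u b = 0] reads [x + x = 0]. *)
Lemma exists_stretch_axis : 2%N \in [pchar F] -> nondegenerate xi ->
  exists2 e, xi e b = 1 & forall u, (xi u e + xi e e * xi u b) * xi b b = 0.
Proof.
move=> charF nondeg.
have [bb0|bb0] := eqVneq (xi b b) 0.
  have [u bu] := nondegenerateP nondeg b_neq0.
  exists ((xi b u)^-1 *: u); last by move=> v; rewrite bb0 mulr0.
  by rewrite linearZl_LR /= (form_sym xi u) mulVf.
exists ((xi b b)^-1 *: b); first by rewrite linearZl_LR /= mulVf.
move=> u; rewrite linearZl_LR !linearZr_LR /= (mulVf bb0) mulr1.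
by rewrite addrr_pchar2 // mul0r.
Qed.

Lemma exists_notin_vline (w : V) :
  (2 <= \dim {:V})%N -> exists x, x \notin <[w]>%VS.
Proof.
move=> dimV; have /subvPn[x _ xw] : ~~ (fullv <= <[w]>)%VS.
  apply/negP => /dimvS; rewrite dim_vline => /(leq_trans dimV).
  by case: (_ != _).
by exists x.
Qed.

Lemma exists_off_pole_and_perp : (2 <= \dim {:V})%N -> nondegenerate xi ->
  exists2 u, u \notin <[b]>%VS & xi u b != 0.
Proof.
move=> dimV nondeg; have [x xb] := exists_notin_vline b dimV.
have [xb0|] := eqVneq (xi x b) 0; last by exists x.
have [bb0|bb0] := eqVneq (xi b b) 0.
  have [u bu] := nondegenerateP nondeg b_neq0.
  exists u; last by rewrite form_sym.
  apply: contra bu => /vlineP[k ->].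
  by rewrite linearZr_LR /= bb0 mulr0.
exists (x + b); last by rewrite linearDl /= xb0 add0r.
by apply: contra xb => xbb; rewrite -(addrK b x) rpredB // memv_line.
Qed.

(** A vector [u] off the hyperplane and off the pole has a perp that is not
    contained in the hyperplane [b]-perp. For [v] the projection of some [y]
    along [u] is taken: [xi v b = xi w y] with [w] the projection of [b], which
    is nonzero because [b] is not a multiple of [u]. *)
Lemma exists_perp_pair : (2 <= \dim {:V})%N -> nondegenerate xi ->
    (forall u, (xi u u == 0) = (xi u b == 0)) ->
  exists u v, [/\ xi u v = 0, xi u b != 0 & xi v b != 0].
Proof.
move=> dimV nondeg selfconjE.
have [u ub ub0] := exists_off_pole_and_perp dimV nondeg.
have uu0 : xi u u != 0 by rewrite selfconjE.
have w0 : b - (xi u b / xi u u) *: u != 0.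
  rewrite subr_eq0; apply: contra ub => /eqP ->.
  apply/vlineP; exists (xi u b / xi u u)^-1.
  by rewrite scalerA mulVf ?scale1r // mulf_neq0 ?invr_eq0.
have [y yw] := nondegenerateP nondeg w0.
exists u, (y - (xi u y / xi u u) *: u); split=> //.
  by rewrite linearBr linearZr_LR /= divfK ?subrr.
apply: contra yw; rewrite !linearBl !linearZl_LR /= (form_sym xi b).
by rewrite mulrAC (mulrAC (xi u b)) [xi u b * _]mulrC.
Qed.

(** The vector [y] witnesses that [x] does not span the pole, since [y] is
    orthogonal to [x] but not to [b]. *)
Lemma vline_in_B1 (x y : V) : (forall u, (xi u u == 0) = (xi u b == 0)) ->
    xi x y = 0 -> xi x b != 0 -> xi y b != 0 ->
  elt (B1 xi (orthov xi <[b]>) <[b]>) <[x]>%VS.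
Proof.
move=> selfconjE xy xb yb; apply/orP; left; rewrite is_point_vline.
apply/and3P; split.
- by apply: contraNneq xb => ->; rewrite linear0l.
- rewrite /regular /Rad -subv0; apply/subvP => z.
  rewrite memv_cap mem_orthov1 => /andP[/vlineP[k ->]].
  rewrite linearZl_LR /= mulf_eq0 selfconjE (negPf xb) orbF => /eqP->.
  by rewrite scale0r mem0v.
apply: contraNneq yb => xbE.
have : b \in <[x]>%VS by rewrite xbE memv_line.
by case/vlineP=> k ->; rewrite linearZr_LR /= form_sym xy mulr0.
Qed.

(** With 0 and 1 as the only scalars, a line has just three points. *)
Lemma exists_scalar_neq01 : (2 <= \dim {:V})%N ->
    (forall l : {vspace V}, is_line l -> exists s : 6.-tuple {vspace V},
       uniq s /\ forall p, p \in s -> is_point p /\ (p <= l)%VS) ->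
  ~ forall d : F, (d == 0) || (d == 1).
Proof.
move=> dimV six F2; have [x xb] := exists_notin_vline b dimV.
have l_line : is_line (<[b]> + <[x]>)%VS.
  rewrite /is_line dimv_disjoint_sum ?dim_vline ?b_neq0.
    by have [x0|] := eqVneq x 0; first by rewrite x0 mem0v in xb.
  apply/eqP; rewrite -subv0; apply/subvP => w; rewrite memv_cap memv0.
  case/andP=> wb /vlineP[k wE]; move: wb; rewrite wE.
  have /orP[/eqP->|/eqP->] := F2 k; first by rewrite scale0r.
  by rewrite scale1r (negPf xb).
have [s [s_uniq sP]] := six _ l_line.
suff /(uniq_leq_size s_uniq) : {subset s <= [:: <[b]>; <[x]>; <[b + x]>]%VS}.
  by rewrite size_tuple.
move=> p /sP[/is_pointP[w w0 ->]]; rewrite -memvE.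
move=> /memv_addP[_ /vlineP[j ->] [_ /vlineP[k ->] wE]].
move: w0; rewrite {}wE !inE.
have /orP[/eqP->|/eqP->] := F2 j; have /orP[/eqP->|/eqP->] := F2 k;
  by rewrite ?scale0r ?scale1r ?addr0 ?add0r ?eqxx ?orbT.
Qed.
End Existence.

Theorem theorem3p15 (F : fieldType) (V : vectType F) (xi : {symmetric V})
    (H b : {vspace V})
    (charF : 2%N \in [pchar F]) (perfF : perfect_field F)
    (dimV : (2 <= \dim {:V})%N)
    (six_points : forall l : {vspace V}, is_line l ->
       exists s : 6.-tuple {vspace V},
         uniq s /\ forall p, p \in s -> is_point p /\ (p <= l)%VS)
    (xi_nondeg : nondegenerate xi) (xi_nalt : ~ alternating xi)
    (H_selfconj : forall p : {vspace V}, is_point p ->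
       ((p <= H)%VS <-> perp xi p p))
    (b_point : is_point b) (b_pole : orthov xi b = H) :
  ~ definable_in (metric_space xi) (B1 xi H b).
Proof.
have [b0 b0_neq0 bE] := is_pointP b_point; subst b H => def.
have selfconjE u : (xi u u == 0) = (xi u b0 == 0).
  have [->|u0] := eqVneq u 0; first by rewrite !linear0l.
  rewrite -!mem_orthov1 !memvE; have := H_selfconj <[u]>%VS.
  by rewrite is_point_vline => /(_ u0) [? ?]; apply/idP/idP.
apply: (exists_scalar_neq01 b0_neq0 dimV six_points) => d.
have [//|d0 /=] := eqVneq d 0; apply/negPn/negP => d1.
have [e eb1 e_b] := exists_stretch_axis b0_neq0 charF xi_nondeg.
have [s aut_s sE] :=
  stretch_B1_automorphism eb1 e_b charF xi_nondeg selfconjE d0.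
have [u [v [uv ub vb]]] := exists_perp_pair b0_neq0 dimV xi_nondeg selfconjE.
have vu : xi v u = 0 by rewrite form_sym.
have u0 : u != 0 by apply: contraNneq ub => ->; rewrite linear0l.
have v0 : v != 0 by apply: contraNneq vb => ->; rewrite linear0l.
pose pu : carrier (B1 xi (orthov xi <[b0]>) <[b0]>) :=
  Sub <[u]>%VS (vline_in_B1 selfconjE uv ub vb).
pose pv : carrier (B1 xi (orthov xi <[b0]>) <[b0]>) :=
  Sub <[v]>%VS (vline_in_B1 selfconjE vu vb ub).
pose p (k : 'I_2) := if k == ord0 then pu else pv.
have [] := @definable_rel_invariant _ _ (metric_space xi) _ s MPerp p def aut_s.
  by move=> k; rewrite /p; case: eqP => _ /=; rewrite is_point_vline ?u0 ?v0.
move=> perp_s _; case: perp_s => [|_ _] /=.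
  by split; rewrite /p /= ?is_point_vline // /perp orthov11 uv.
rewrite !sE /p /= !limg_line /perp orthov11 !lfunE /=.
by rewrite (negPf (stretch_not_perp _ _ _ _ _ _ _ _)).
Qed.
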